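(* Let $(h_{m,t})_{1\le m\le M,\,t\ge0}$ be nonzero channel coefficients and assume there is $h_{\text{ub}}<\infty$ with $\min_m|h_{m,t}|\le h_{\text{ub}}$ for all $t$. Let $\beta\in\mathbb{R}$ and, for each horizon $T$, run AdaScale (defined in the context) with $V=V_0T^\beta$, where $V_0>0$ is a constant. Let $\hat x_t$ (depending on $T$) be its decisions, $x_t^\star$ (depending on $T$) an offline optimal solution of problem (P) with horizon $T$, $\hat\sigma_{m,t}=\sigma_{m,t}(\hat x_t)$ and $\sigma^\star_{m,t}=\sigma_{m,t}(x^\star_t)$. Then, as $T\to\infty$, $$\frac1T\sum_{t=0}^{T-1}\frac{d\sigma_n^2}{h_{\min,t}^2}\Big(\frac1{\hat x_t}-\frac1{x_{\max}}\Big)-\nu\le\mathcal{O}\big(T^{\frac{\beta-1}{2}}\big)$$ and $$\frac1T\sum_{t=0}^{T-1}\sum_{m=1}^M\Big(\rho_\alpha(q_m,\hat\sigma_{m,t})-\rho_\alpha(q_m,\sigma^\star_{m,t})\Big)\le\mathcal{O}\big(T^{\max\{1-\beta,\frac{1-\beta}{2}\}}\big),$$ where ''$\le\mathcal{O}(T^{s})$'' means that there are constants $C>0$ and $T_0$, independent of $T$, such that the left-hand side is at most $CT^{s}$ for all $T\ge T_0$.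
   Context: Parameters not depending on $T$: integers $M,d\ge1$ and $\alpha>1$; reals $\sigma_n,G,P_{\max}>0$ and $\nu\ge0$; integers $1\le B_m\le n_m$ and $q_m=B_m/n_m$, $k_m=\sqrt{1+(1-q_m)/B_m}$ for $m=1,\dots,M$. Put $h_{\min,t}=\min_m\frac{|h_{m,t}|}{k_m}$ and $x_{\max}=\frac{P_{\max}dM^2}{G^2}$. For $q\in(0,1]$, $\sigma>0$: $\rho_\alpha(q,\sigma)=\frac{1}{\alpha-1}\ln\big[\sum_{k=0}^{\alpha}\binom{\alpha}{k}(1-q)^{\alpha-k}q^k\exp\big(\frac{k^2-k}{2\sigma^2}\big)\big]$ (with $0^0=1$). For $x>0$: $\sigma_{m,t}(x)=\frac{MB_m\sigma_n}{\sqrt{2x}\,G\,h_{\min,t}}$. Problem (P) with horizon $T$: minimize $\frac1T\sum_{t=0}^{T-1}\sum_{m=1}^M\rho_\alpha(q_m,\sigma_{m,t}(x_t))$ over $(x_0,\dots,x_{T-1})$ subject to $\frac1T\sum_{t=0}^{T-1}\frac{d\sigma_n^2}{h_{\min,t}^2}\big(\frac1{x_t}-\frac1{x_{\max}}\big)\le\nu$ and $0<x_t\le x_{\max}$ for all $t$. The offline optimal solution is a minimizer of (P) with all $h_{m,t}$ known. AdaScale with parameter $V>0$ and horizon $T$: start with $Q_0=0$. For $t=0,\dots,T-1$, let $\hat x_t$ be a minimizer over $x\in(0,x_{\max}]$ of $$V\sum_{m=1}^M\rho_\alpha(q_m,\sigma_{m,t}(x))+Q_t\frac{d\sigma_n^2}{h_{\min,t}^2}\Big(\frac1x-\frac1{x_{\max}}\Big)+\frac12\Big(\frac{d\sigma_n^2}{h_{\min,t}^2}\Big)^2\Big(\frac1x-\frac1{x_{\max}}\Big)^2,$$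 and update the virtual queue $Q_{t+1}=\max\big\{Q_t+\frac{d\sigma_n^2}{h_{\min,t}^2}\big(\frac1{\hat x_t}-\frac1{x_{\max}}\big)-\nu,\,0\big\}$. *)

(* Defs.v *)
From mathcomp Require Import all_boot all_order all_algebra.
From mathcomp Require Import all_classical all_reals all_analysis.
From mathcomp Require Import complex.

Set Implicit Arguments.
Unset Strict Implicit.
Unset Printing Implicit Defensive.

Import Order.TTheory GRing.Theory Num.Theory.
Local Open Scope ring_scope.

(* Minimum of finitely many reals. The unit of the iterated minimum is one of
   the values, so that it does not affect the result when 0 < M; the value for
   M = 0 is junk. *)
Definition fin_min (R : realType) (M : nat) (f : 'I_M -> R) : R :=
  \big[Num.min/head 0 (codom f)]_(m < M) f m.

Lemma fin_minP (R : realType) (M : nat) (f : 'I_M -> R) : (0 < M)%N ->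
  (exists m, fin_min f = f m) /\ (forall m, fin_min f <= f m).
Proof.
move=> M0; split; last by move=> m; exact: bigmin_le.
rewrite /fin_min.
have [m ->] : exists m, head 0 (codom f) = f m.
  have : (0 < size (codom f))%N by rewrite size_codom card_ord.
  have : {subset codom f <= codom f} by [].
  case: {1 3 4}(codom f) => //= y s /(_ y); rewrite mem_head => /(_ isT).
  by move=> /codomP[m ->] _; exists m.
elim/big_ind: _ => [|x y [i ->] [j ->]|i _]; [by exists m| |by exists i].
by case: (leP (f i) (f j)) => _; [exists i|exists j].
Qed.

Definition is_minimizer (T : Type) (R : realType) (D : set T) (f : T -> R)
    (x : T) : Prop :=
  D x /\ forall y, D y -> f x <= f y.

(* f(T) <= O(T^s) as T -> oo: a one-sided bound, f may be very negative. *)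
Definition le_bigO (R : realType) (f : nat -> R) (s : R) : Prop :=
  exists C : R, 0 < C /\
    exists T0 : nat, forall T : nat, (T0 <= T)%N -> f T <= C * T%:R `^ s.

Record params (R : realType) := Params {
  M : nat;
  d : nat;
  alpha : nat;
  sigma_n : R;
  G : R;
  Pmax : R;
  nu : R;
  B : 'I_M -> nat;
  n : 'I_M -> nat }.

(* Renyi-type privacy loss; the convention 0^0 = 1 holds for ^+. *)
Definition rho (R : realType) (a : nat) (q s : R) : R :=
  (a%:R - 1)^-1 *
  ln (\sum_(k < a.+1) 'C(a, k)%:R * (1 - q) ^+ (a - k) * q ^+ k *
        expR ((k%:R ^+ 2 - k%:R) / (2 * s ^+ 2))).

Section Model.
Variables (R : realType) (p : params R).
Variable h : 'I_(M p) -> nat -> R[i].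
Implicit Types (m : 'I_(M p)) (t T : nat) (x : nat -> R).

Definition q m : R := (B m)%:R / (n m)%:R.

Definition k m : R := Num.sqrt (1 + (1 - q m) / (B m)%:R).

Definition h_min t : R := fin_min (fun m => Normc.normc (h m t) / k m).

Definition x_max : R := Pmax p * (d p)%:R * (M p)%:R ^+ 2 / G p ^+ 2.

Definition sigma m t (y : R) : R :=
  (M p)%:R * (B m)%:R * sigma_n p / (Num.sqrt (2 * y) * G p * h_min t).

Definition privacy t (y : R) : R :=
  \sum_(m < M p) rho (alpha p) (q m) (sigma m t y).

Definition excess t (y : R) : R :=
  (d p)%:R * sigma_n p ^+ 2 / h_min t ^+ 2 * (y^-1 - x_max^-1).

(* Decision sequences are total functions on nat; with horizon T, only the
   values at t < T are constrained and used. *)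
Definition avg_privacy T x : R := T%:R^-1 * \sum_(t < T) privacy t (x t).

Definition avg_excess T x : R := T%:R^-1 * \sum_(t < T) excess t (x t).

Definition feasible T : set (nat -> R) :=
  [set x | avg_excess T x <= nu p /\
           forall t, (t < T)%N -> 0 < x t <= x_max].

Definition offline_optimal T x : Prop :=
  is_minimizer (feasible T) (avg_privacy T) x.

Fixpoint queue x t : R :=
  if t is t'.+1 then Num.max (queue x t' + excess t' (x t') - nu p) 0 else 0.

Definition adascale_objective (V Q : R) t (y : R) : R :=
  V * privacy t y + Q * excess t y + 2^-1 * excess t y ^+ 2.

(* x is a possible decision sequence of AdaScale: the rule below determines
   x t from x 0, ..., x (t - 1) up to the choice of a minimizer. *)
Definition adascale (V : R) T x : Prop :=
  forall t, (t < T)%N ->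
    is_minimizer [set y : R | 0 < y <= x_max]
      (adascale_objective V (queue x t) t) (x t).

End Model.

(* Main.v *)
Require Import Defs.
From mathcomp Require Import all_boot all_order all_algebra.
From mathcomp Require Import all_classical all_reals all_analysis.
From mathcomp Require Import complex ring lra.

Import Order.TTheory GRing.Theory Num.Theory.
Local Open Scope ring_scope.

(** Write y_t for the excess of a decision and f_t for its privacy loss. The
    channel bound makes f_t(x_max) <= F for all t, and x_max has excess 0, so
    optimality of the AdaScale step against x_max gives
    Q_t y_t + y_t^2 / 2 <= V F. As nu >= 0, Q_(t+1)^2 <= (Q_t + y_t)^2
    <= Q_t^2 + 2 V F, hence Q_t <= sqrt (2 T V F) for all t <= T, and the
    average excess is at most nu + Q_T / T. Optimality against the offline
    decision, of excess y*_t, gives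
    V (f_t(xhat_t) - f_t(x*_t)) <= Q_t y*_t + y*_t^2 / 2; since the y*_t are
    nonnegative with sum at most T nu, the sum of their squares is at most
    (T nu)^2, and dividing the summed inequality by T V gives the two rates
    T^((1 - beta) / 2) and T^(1 - beta). *)

(** * Sign and monotonicity of the privacy loss, and a sum-of-squares inequality *)

Lemma natr_sqr_subr_ge0 (R : realType) (k : nat) : 0 <= k%:R ^+ 2 - k%:R :> R.
Proof.
by rewrite subr_ge0 -natrX ler_nat; case: k => // k; rewrite -mulnn leq_pmulr.
Qed.

(** The binomial weights sum to 1, and [k ^ 2 >= k] makes every exponential factor at least 1. This
    keeps the argument of [ln] positive and its value nonnegative. *)
Lemma rho_sum_ge1 (R : realType) (a : nat) (q s : R) :
  0 <= q <= 1 ->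
  1 <= \sum_(k < a.+1) 'C(a, k)%:R * (1 - q) ^+ (a - k) * q ^+ k *
         expR ((k%:R ^+ 2 - k%:R) / (2 * s ^+ 2)).
Proof.
move=> /andP[q0 q1].
have one_sum : 1 = \sum_(k < a.+1) 'C(a, k)%:R * (1 - q) ^+ (a - k) * q ^+ k.
  rewrite -[LHS](expr1n _ a) -[X in X ^+ a](subrK q) exprDn.
  by apply: eq_bigr => k _; rewrite -mulr_natl mulrA.
rewrite [leLHS]one_sum; apply: ler_sum => k _; apply: ler_peMr.
  by rewrite !mulr_ge0 ?exprn_ge0 ?subr_ge0.
rewrite -[leLHS]expR0 ler_expR divr_ge0 ?natr_sqr_subr_ge0 //.
by rewrite mulr_ge0 ?sqr_ge0.
Qed.

Lemma rho_ge0 (R : realType) (a : nat) (q s : R) :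
  (1 < a)%N -> 0 <= q <= 1 -> 0 <= rho a q s.
Proof.
move=> a1 q01; rewrite /rho mulr_ge0 //.
  by rewrite invr_ge0 subr_ge0 ler1n ltnW.
by rewrite ln_ge0 // rho_sum_ge1.
Qed.

Lemma rho_antitone (R : realType) (a : nat) (q s s' : R) :
  (1 < a)%N -> 0 <= q <= 1 -> 0 < s <= s' -> rho a q s' <= rho a q s.
Proof.
move=> a1 q01 /andP[s0 ss']; rewrite /rho ler_wpM2l //.
  by rewrite invr_ge0 subr_ge0 ler1n ltnW.
rewrite ler_ln ?posrE ?(lt_le_trans ltr01) ?rho_sum_ge1 //.
have /andP[q0 q1] := q01.
apply: ler_sum => k _; apply: ler_wpM2l.
  by rewrite !mulr_ge0 ?exprn_ge0 ?subr_ge0.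
rewrite ler_expR ler_wpM2l //.
  exact: natr_sqr_subr_ge0.
have s'0 := lt_le_trans s0 ss'.
rewrite lef_pV2 ?posrE ?mulr_gt0 ?exprn_gt0 //.
by rewrite ler_pM2l // lerXn2r ?nnegrE // ltW.
Qed.

(** Expanding the square leaves only nonnegative cross terms. *)
Lemma sum_sqr_le {R : realDomainType} {T : nat} {y : nat -> R} :
  (forall t, (t < T)%N -> 0 <= y t) ->
  \sum_(t < T) y t ^+ 2 <= (\sum_(t < T) y t) ^+ 2.
Proof.
elim: T => [|T IH] y0; first by rewrite !big_ord0 expr0n.
rewrite !big_ord_recr /= sqrrD lerD2r.
apply: (le_trans (IH _)); first by move=> t tT; apply/y0/ltnW.
rewrite lerDl mulrn_wge0 // mulr_ge0 ?y0 // sumr_ge0 // => t _.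
by apply/y0/ltnW/ltn_ord.
Qed.

(** * Bounds on the model quantities *)

Lemma q_itv {R : realType} {p : params R} (m : 'I_(M p)) :
  (1 <= B m <= n m)%N -> 0 <= q m <= 1.
Proof.
move=> /andP[B1 Bn]; rewrite /q divr_ge0 //= ler_pdivrMr ?mul1r ?ler_nat //.
by rewrite ltr0n (leq_trans B1).
Qed.

Lemma k_ge1 {R : realType} {p : params R} (m : 'I_(M p)) :
  (1 <= B m <= n m)%N -> 1 <= k m.
Proof.
move=> /q_itv/andP[_ q1]; rewrite /k -[leLHS]sqrtr1 ler_wsqrtr //.
by rewrite lerDl divr_ge0 ?subr_ge0.
Qed.

Lemma k_gt0 {R : realType} {p : params R} (m : 'I_(M p)) :
  (1 <= B m <= n m)%N -> 0 < k m.
Proof. by move=> /k_ge1; exact: lt_le_trans. Qed.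

Lemma normc_ge0 (R : rcfType) (z : R[i]) : 0 <= Normc.normc z.
Proof. by case: z => x y; exact: sqrtr_ge0. Qed.

Lemma h_min_gt0 {R : realType} {p : params R} (h : 'I_(M p) -> nat -> R[i])
    (t : nat) :
  (0 < M p)%N -> (forall m : 'I_(M p), (1 <= B m <= n m)%N) ->
  (forall m, h m t != 0) -> 0 < h_min h t.
Proof.
move=> M0 hB h0; rewrite /h_min.
have [[m ->] _] := fin_minP (fun m => Normc.normc (h m t) / k m) M0.
rewrite divr_gt0 ?k_gt0 // lt_def normc_ge0 andbT.
by apply: contra (h0 m) => /eqP/Normc.eq0_normc ->.
Qed.

(** Each [k m] is at least 1, so dividing by it only shrinks; the index attaining the unweighted
    minimum is the one to test. This carries the channel bound over to [h_min]. *)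
Lemma h_min_le {R : realType} {p : params R} (h : 'I_(M p) -> nat -> R[i])
    (t : nat) :
  (0 < M p)%N -> (forall m : 'I_(M p), (1 <= B m <= n m)%N) ->
  h_min h t <= fin_min (fun m : 'I_(M p) => Normc.normc (h m t)).
Proof.
move=> M0 hB; have [[m ->] _] := fin_minP (fun m => Normc.normc (h m t)) M0.
have [_ /(_ m) hm] := fin_minP (fun m => Normc.normc (h m t) / k m) M0.
apply: (le_trans hm); rewrite ler_pdivrMr ?k_gt0 //.
by rewrite ler_peMr ?normc_ge0 ?k_ge1.
Qed.

Lemma excess_ge0 {R : realType} {p : params R} (h : 'I_(M p) -> nat -> R[i])
    (t : nat) {y : R} :
  0 < y <= x_max p -> 0 <= excess h t y.
Proof.
move=> /andP[y0 yx]; rewrite /excess mulr_ge0 //.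
  by rewrite divr_ge0 ?sqr_ge0 // mulr_ge0 ?sqr_ge0.
by rewrite subr_ge0 lef_pV2 ?posrE // (lt_le_trans y0).
Qed.

Lemma excess_x_max {R : realType} {p : params R} (h : 'I_(M p) -> nat -> R[i])
    (t : nat) :
  excess h t (x_max p) = 0.
Proof. by rewrite /excess subrr mulr0. Qed.

Lemma privacy_ge0 {R : realType} {p : params R} (h : 'I_(M p) -> nat -> R[i])
    (t : nat) (y : R) :
  (1 < alpha p)%N -> (forall m : 'I_(M p), (1 <= B m <= n m)%N) ->
  0 <= privacy h t y.
Proof.
by move=> ha hB; apply: sumr_ge0 => m _; apply: rho_ge0 => //; exact: q_itv.
Qed.

(** A larger [h_min] means less noise and hence more loss, so the worst case is [h_ub] in place of
    [h_min], which no longer depends on time. *)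
Lemma privacy_bounded {R : realType} {p : params R}
    {h : 'I_(M p) -> nat -> R[i]} {h_ub y : R} :
  (0 < M p)%N -> (1 < alpha p)%N -> 0 < sigma_n p -> 0 < G p -> 0 < y ->
  (forall m : 'I_(M p), (1 <= B m <= n m)%N) ->
  (forall t, 0 < h_min h t <= h_ub) ->
  exists F, 0 <= F /\ forall t, privacy h t y <= F.
Proof.
move=> M0 ha hs hG y0 hB hh.
pose s (m : 'I_(M p)) : R :=
  (M p)%:R * (B m)%:R * sigma_n p / (Num.sqrt (2 * y) * G p * h_ub).
have h_ub0 : 0 < h_ub by have /andP[h0 hl] := hh 0; exact: lt_le_trans hl.
have priv t : privacy h t y <= \sum_(m < M p) rho (alpha p) (q m) (s m).
  have /andP[h0 hl] := hh t.
  apply: ler_sum => m _; have /andP[B1 _] := hB m.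
  apply: rho_antitone => //; first exact: q_itv.
  rewrite /s /sigma divr_gt0 ?mulr_gt0 ?ltr0n ?sqrtr_gt0 ?mulr_gt0 //=.
  rewrite ler_wpM2l ?mulr_ge0 ?(ltW hs) //.
  rewrite lef_pV2 ?posrE ?mulr_gt0 ?sqrtr_gt0 ?mulr_gt0 //.
  by rewrite ler_wpM2l ?mulr_ge0 ?sqrtr_ge0 // ltW.
exists (\sum_(m < M p) rho (alpha p) (q m) (s m)); split => //.
by apply: le_trans (priv 0%N); exact: privacy_ge0.
Qed.

(** * The virtual queue and the drift argument *)

Lemma queue_ge0 {R : realType} {p : params R} (h : 'I_(M p) -> nat -> R[i])
    (x : nat -> R) (t : nat) :
  0 <= queue h x t.
Proof. by case: t => //= t; rewrite le_max lexx orbT. Qed.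

(** Truncation at 0 can only raise the queue above the untruncated running sum. *)
Lemma sum_excess_le_queue {R : realType} {p : params R}
    (h : 'I_(M p) -> nat -> R[i]) (x : nat -> R) (T : nat) :
  \sum_(t < T) excess h t (x t) - T%:R * nu p <= queue h x T.
Proof.
elim: T => [|T IH] /=; first by rewrite big_ord0 mul0r subr0.
rewrite big_ord_recr /= le_max -natr1; apply/orP; left; lra.
Qed.

Lemma adascale_queue_sqr_le {R : realType} {p : params R}
    {h : 'I_(M p) -> nat -> R[i]} {V F : R} {x : nat -> R} {T t : nat} :
  0 < x_max p -> 0 <= nu p -> 0 <= V ->
  (forall s y, 0 <= privacy h s y) ->
  (forall s, privacy h s (x_max p) <= F) ->
  adascale h V T x -> (t <= T)%N ->
  queue h x t ^+ 2 <= t%:R * (2 * V * F).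
Proof.
move=> x0 hnu V0 f0 fF ada; elim: t => [|t IH] tT.
  by rewrite expr0n mul0r.
have {IH} IH := IH (ltnW tT).
have [xt /(_ (x_max p))] := ada _ tT.
rewrite /= /adascale_objective excess_x_max x0 lexx => /(_ isT).
have := excess_ge0 h t xt; have := queue_ge0 h x t.
have := ler_wpM2l V0 (fF t); have := mulr_ge0 V0 (f0 t (x t)).
set Q := queue h x t in IH *; set y := excess h t (x t).
move=> Vf0 VF Q0 y0 opt.
(* As [nu p] and [Q + y] are nonnegative, the updated queue is at most [Q + y]. Squaring adds
   [2 * Q * y + y ^+ 2], which is twice the quantity that [opt] bounds by [V * F]. *)
apply: (@le_trans _ _ ((Q + y) ^+ 2)).
  rewrite lerXn2r ?nnegrE ?le_max ?lexx ?orbT ?addr_ge0 //.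
  by rewrite ge_max addr_ge0 // andbT; lra.
by rewrite -natr1; nra.
Qed.

Lemma adascale_privacy_gap {R : realType} {p : params R}
    {h : 'I_(M p) -> nat -> R[i]} {V K : R} {x z : nat -> R} {T : nat} :
  (0 < T)%N -> 0 <= nu p ->
  adascale h V T x -> feasible h T z ->
  (forall t, (t < T)%N -> queue h x t <= K) ->
  V * \sum_(t < T) (privacy h t (x t) - privacy h t (z t)) <=
    K * (T%:R * nu p) + 2^-1 * (T%:R * nu p) ^+ 2.
Proof.
move=> T0 hnu ada [avg zx] QK.
have y0 t : (t < T)%N -> 0 <= excess h t (z t) by move=> /zx; exact: excess_ge0.
have sy : \sum_(t < T) excess h t (z t) <= T%:R * nu p.
  by rewrite -ler_pdivrMl ?ltr0n.
have sy0 : 0 <= \sum_(t < T) excess h t (z t) by apply: sumr_ge0 => t _; exact: y0.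
have K0 : 0 <= K by rewrite (le_trans (queue_ge0 h x 0)) ?QK.
apply: (@le_trans _ _ (\sum_(t < T)
    (K * excess h t (z t) + 2^-1 * excess h t (z t) ^+ 2))).
  rewrite mulr_sumr; apply: ler_sum => t _.
  (* The minimizer is tested against [z t]; its own two excess terms are nonnegative and dropped,
     and the queue is replaced by [K]. *)
  have [xt /(_ (z t) (zx t (ltn_ord t)))] := ada _ (ltn_ord t).
  rewrite /adascale_objective.
  have := mulr_ge0 (queue_ge0 h x t) (excess_ge0 h t xt).
  have := sqr_ge0 (excess h t (x t)).
  have := ler_wpM2r (y0 t (ltn_ord t)) (QK t (ltn_ord t)).
  lra.
rewrite big_split -!mulr_sumr /= lerD ?ler_wpM2l ?invr_ge0 //.
by rewrite (le_trans (sum_sqr_le y0)) // lerXn2r ?nnegrE // mulr_ge0.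
Qed.

(** * The two rates *)

Theorem corollary1 (R : realType) (p : params R)
    (hM : (1 <= M p)%N) (hd : (1 <= d p)%N) (halpha : (1 < alpha p)%N)
    (hsigma : 0 < sigma_n p) (hG : 0 < G p) (hPmax : 0 < Pmax p)
    (hnu : 0 <= nu p)
    (hB : forall m : 'I_(M p), (1 <= B m <= n m)%N)
    (h : 'I_(M p) -> nat -> R[i])
    (h_neq0 : forall (m : 'I_(M p)) (t : nat), h m t != 0)
    (h_ub : R)
    (h_bounded : forall t : nat,
        fin_min (fun m : 'I_(M p) => Normc.normc (h m t)) <= h_ub)
    (beta V0 : R) (hV0 : 0 < V0)
    (xhat xstar : nat -> nat -> R)
    (hxhat : forall T : nat, (1 <= T)%N ->
        adascale h (V0 * T%:R `^ beta) T (xhat T))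
    (hxstar : forall T : nat, (1 <= T)%N -> offline_optimal h T (xstar T)) :
  le_bigO
    (fun T : nat =>
       T%:R^-1 * \sum_(t < T) excess h t (xhat T t) - nu p)
    ((beta - 1) / 2) /\
  le_bigO
    (fun T : nat =>
       T%:R^-1 * \sum_(t < T) \sum_(m < M p)
         (rho (alpha p) (q m) (sigma h m t (xhat T t))
          - rho (alpha p) (q m) (sigma h m t (xstar T t))))
    (Num.max (1 - beta) ((1 - beta) / 2)).
Proof.
have h_min_itv t : 0 < h_min h t <= h_ub.
  rewrite h_min_gt0 //=; apply: le_trans (h_bounded t); exact: h_min_le.
have x_max0 : 0 < x_max p by rewrite divr_gt0 ?mulr_gt0 ?exprn_gt0 ?ltr0n.
have [F [F0 fF]] := privacy_bounded hM halpha hsigma hG x_max0 hB h_min_itv.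
have f0 t y : 0 <= privacy h t y by exact: privacy_ge0.
(* With V = V0 T^beta the queue bound sqrt (2 T V F) equals A T^((beta + 1) / 2). It is kept as T
   times T^((beta - 1) / 2), so that averaging over T leaves the first rate. *)
pose A := Num.sqrt (2 * V0 * F).
have A0 : 0 <= A := sqrtr_ge0 _.
have queue_le T t : (1 <= T)%N -> (t <= T)%N ->
    queue h (xhat T) t <= A * (T%:R * T%:R `^ ((beta - 1) / 2)).
  move=> T1 tT; have T0 : 0 < T%:R :> R by rewrite ltr0n.
  have V_ge0 : 0 <= V0 * T%:R `^ beta by rewrite mulr_ge0 ?powR_ge0 ?ltW.
  have W0 : 0 <= T%:R * T%:R `^ ((beta - 1) / 2) :> R.
    by rewrite mulr_ge0 ?powR_ge0.
  have W2 : (T%:R * T%:R `^ ((beta - 1) / 2)) ^+ 2 = T%:R * T%:R `^ beta :> R.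
    rewrite exprMn [X in _ * X]expr2 -powRD; last by rewrite (gt_eqF T0) implybT.
    rewrite -splitr powRB; last by rewrite (gt_eqF T0) implybT.
    by rewrite powRr1 ?ltW //; field; rewrite gt_eqF.
  rewrite -ler_sqr ?nnegrE ?queue_ge0 ?mulr_ge0 // exprMn W2.
  rewrite sqr_sqrtr ?mulr_ge0 ?(ltW hV0) //.
  have := adascale_queue_sqr_le x_max0 hnu V_ge0 f0 fF (hxhat T T1) tT.
  move=> /le_trans; apply.
  have -> : 2 * V0 * F * (T%:R * T%:R `^ beta) =
      T%:R * (2 * (V0 * T%:R `^ beta) * F) by ring.
  by rewrite ler_wpM2r ?ler_nat // mulr_ge0 // mulr_ge0.
split.
(* Adding 1 keeps the constant positive even if [A] is 0. *)
- exists (A + 1); split; first by rewrite ltr_wpDl.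
  exists 1%N => T T1; have T0 : 0 < T%:R :> R by rewrite ltr0n.
  have le := le_trans (sum_excess_le_queue h (xhat T) T) (queue_le T T T1 (leqnn T)).
  apply: (@le_trans _ _ (A * T%:R `^ ((beta - 1) / 2))); last first.
    by rewrite ler_wpM2r ?powR_ge0 ?lerDl.
  rewrite lerBlDr ler_pdivrMl // mulrDr; lra.
- set e := Num.max _ _.
  (* The two summands are the coefficients of T^((1 - beta) / 2) and T^(1 - beta) once the gap bound
     is divided by T V. *)
  pose C := V0^-1 * (A * nu p + 2^-1 * nu p ^+ 2).
  have C0 : 0 <= C.
    by rewrite mulr_ge0 ?invr_ge0 ?addr_ge0 ?mulr_ge0 ?invr_ge0 ?sqr_ge0 // ltW.
  exists (C + 1); split; first by rewrite ltr_wpDl.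
  exists 1%N => T T1; have T0 : 0 < T%:R :> R by rewrite ltr0n.
  have Tb0 : 0 < T%:R `^ beta :> R by rewrite powR_gt0.
  have V_gt0 : 0 < V0 * T%:R `^ beta by rewrite mulr_gt0.
  apply: (@le_trans _ _ (C * T%:R `^ e)); last first.
    by rewrite ler_wpM2r ?powR_ge0 ?lerDl.
  have [feas _] := hxstar T T1.
  have := adascale_privacy_gap T1 hnu (hxhat T T1) feas
    (fun t tT => queue_le T t T1 (ltnW tT)).
  under [in X in _ -> X]eq_bigr do rewrite sumrB.
  rewrite -ler_pdivlMl // => gap.
  rewrite ler_pdivrMl //; apply: (le_trans gap).
  (* For T at least 1 powers increase with the exponent, so the maximum [e] dominates both rates. *)
  have le1 : T%:R `^ ((1 - beta) / 2) <= T%:R `^ e :> R.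
    by rewrite ler_powR ?ler1n // le_max lexx orbT.
  have le2 : T%:R `^ (1 - beta) <= T%:R `^ e :> R.
    by rewrite ler_powR ?ler1n // le_max lexx.
  (* Both rates are expressed through the powers already present in the gap bound, which [field] can
     treat as atoms. *)
  have E2 : T%:R `^ (1 - beta) = T%:R / T%:R `^ beta :> R.
    rewrite powRB; last by rewrite (gt_eqF T0) implybT.
    by rewrite powRr1 // ltW.
  have E1 : T%:R `^ ((1 - beta) / 2) =
      T%:R * T%:R `^ ((beta - 1) / 2) / T%:R `^ beta :> R.
    rewrite mulrAC -E2 -powRD; last by rewrite (gt_eqF T0) implybT.
    by congr (_ `^ _); field.
  have -> : (V0 * T%:R `^ beta)^-1 *
      (A * (T%:R * T%:R `^ ((beta - 1) / 2)) * (T%:R * nu p) +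
       2^-1 * (T%:R * nu p) ^+ 2) =
      T%:R * (V0^-1 * (A * nu p * T%:R `^ ((1 - beta) / 2) +
        2^-1 * nu p ^+ 2 * T%:R `^ (1 - beta))).
    by rewrite E1 E2; field; rewrite !gt_eqF.
  rewrite ler_wpM2l ?(ltW T0) // /C -[leRHS]mulrA.
  rewrite ler_wpM2l ?invr_ge0 ?(ltW hV0) // [leRHS]mulrDl.
  by rewrite lerD ?ler_wpM2l ?mulr_ge0 ?sqr_ge0.
Qed.
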